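(* Let $E$ be a finite graph and $K$ any field. Then the Cohn path algebra $C_K(E)$ has Unbounded Generating Number if and only if $E$ satisfies at least one of the following conditions: (1) $E$ contains a source; or (2) $E$ contains a source cycle.
   Context: A ring $R$ (nonzero, associative, with identity) has Unbounded Generating Number (UGN) if, for each positive integer $m$, any set of generators for the free right $R$-module $R^m$ has cardinality $\geq m$. A (directed) graph $E=(E^0,E^1,s,r)$ consists of disjoint sets $E^0$ (vertices) and $E^1$ (edges) and maps $s,r:E^1\to E^0$ (source and range); it is finite if $E^0$ and $E^1$ are finite. Graphs are assumed to have at least one vertex. A vertex $v$ is a source if $r^{-1}(v)=\emptyset$. For a field $K$, the Cohn path algebra $C_K(E)$ is the $K$-algebra generated by the set $\{v,e,e^*\mid v\in E^0,e\in E^1\}$ subject to, for all $v,w\in E^0$, $e,f\in E^1$: (1) $vw=\delta_{v,w}w$; (2) $s(e)e=e=er(e)$ and $r(e)e^*=e^*=e^*s(e)$; (3) $e^*f=\delta_{e,f}r(e)$. For finite $E$ it is unital with identity $\sum_{v\in E^0}v$. A closed path is a sequence of edges $e_1\cdots e_n$ ($n\ge 1$) with $r(e_i)=s(e_{i+1})$ for $1\le i<n$ and $r(e_n)=s(e_1)$. If the vertices $s(e_1),\dots,s(e_n)$ are distinct, the subgraph $c$ with vertex set $c^0=\{s(e_1),\dots,s(e_n)\}$ and edge set $\{e_1,\dots,e_n\}$ is called a cycle. A cycle $c$ in $E$ is a source cycle if $|r^{-1}(v)|=1$ for all $v\in c^0$. *)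

(* Defs.v *)
From HB Require Import structures.
From mathcomp Require Import all_boot all_order all_algebra.
From mathcomp Require Import boolp classical_sets functions cardinality.
From mathcomp Require Import generic_quotient.

Set Implicit Arguments.
Unset Strict Implicit.
Unset Printing Implicit Defensive.

Import GRing.Theory.

Local Open Scope ring_scope.

(* A right R-module is a left module over the converse ring R^c, with
   [(a : R^c) *: x] standing for x a.  In particular 'rV[R^c]_m is the free
   right R-module R^m, since in it (a *: x) 0 i = x 0 i * a (product in R). *)

Definition generating (A : nzRingType) (M : lmodType A) (S : set M) : Prop :=
  forall x : M, exists (n : nat) (g : 'I_n -> M) (c : 'I_n -> A),
    (forall i, S (g i)) /\ x = \sum_(i < n) c i *: g i.

Definition unbounded_generating_number (R : nzRingType) : Prop :=
  forall m : nat, (0 < m)%N ->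
  forall S : set 'rV[R^c]_m, generating S -> (`I_m #<= S)%card.

Record finite_graph := FiniteGraph {
  vertex : finType;
  edge : finType;
  src : edge -> vertex;
  rng : edge -> vertex;
  vertex_gt0 : (0 < #|vertex|)%N
}.

Section Graph.
Variable E : finite_graph.

Definition is_source (v : vertex E) : bool :=
  [set e : edge E | rng e == v] == finset.set0.

(* [cycle] includes the wrap-around condition from the last edge to the
   first one. *)
Definition is_closed_path (p : seq (edge E)) : bool :=
  (p != [::]) && cycle (fun e f => rng e == src f) p.

Definition is_cycle (p : seq (edge E)) : bool :=
  is_closed_path p && uniq [seq src e | e <- p].

Definition is_source_cycle (p : seq (edge E)) : bool :=
  is_cycle p &&
  all (fun v => #|[set e : edge E | rng e == v]| == 1%N) [seq src e | e <- p].

End Graph.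

Section Presentation.
Variables (K : fieldType) (X : Type).

(* Terms in the operations of (not necessarily unital) K-algebras. *)
Inductive alg_term : Type :=
  | TGen of X
  | TZero
  | TOpp of alg_term
  | TAdd of alg_term & alg_term
  | TMul of alg_term & alg_term
  | TScale of K & alg_term.

Variable rel : alg_term -> alg_term -> Prop.

(* The least congruence that contains [rel] and whose quotient is an
   associative K-algebra. *)
Inductive alg_cong : alg_term -> alg_term -> Prop :=
  | cong_rel t u : rel t u -> alg_cong t u
  | cong_refl t : alg_cong t t
  | cong_sym t u : alg_cong t u -> alg_cong u t
  | cong_trans u t w : alg_cong t u -> alg_cong u w -> alg_cong t w
  | cong_opp t t' : alg_cong t t' -> alg_cong (TOpp t) (TOpp t')
  | cong_add t t' u u' :
      alg_cong t t' -> alg_cong u u' -> alg_cong (TAdd t u) (TAdd t' u')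
  | cong_mul t t' u u' :
      alg_cong t t' -> alg_cong u u' -> alg_cong (TMul t u) (TMul t' u')
  | cong_scale k t t' : alg_cong t t' -> alg_cong (TScale k t) (TScale k t')
  | cong_addA t u w : alg_cong (TAdd t (TAdd u w)) (TAdd (TAdd t u) w)
  | cong_addC t u : alg_cong (TAdd t u) (TAdd u t)
  | cong_add0 t : alg_cong (TAdd TZero t) t
  | cong_addN t : alg_cong (TAdd (TOpp t) t) TZero
  | cong_mulA t u w : alg_cong (TMul t (TMul u w)) (TMul (TMul t u) w)
  | cong_mulDl t u w :
      alg_cong (TMul (TAdd t u) w) (TAdd (TMul t w) (TMul u w))
  | cong_mulDr t u w :
      alg_cong (TMul t (TAdd u w)) (TAdd (TMul t u) (TMul t w))
  | cong_scaleA k l t : alg_cong (TScale k (TScale l t)) (TScale (k * l) t)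
  | cong_scale1 t : alg_cong (TScale 1 t) t
  | cong_scaleDr k t u :
      alg_cong (TScale k (TAdd t u)) (TAdd (TScale k t) (TScale k u))
  | cong_scaleDl k l t :
      alg_cong (TScale (k + l) t) (TAdd (TScale k t) (TScale l t))
  | cong_scaleAl k t u :
      alg_cong (TScale k (TMul t u)) (TMul (TScale k t) u)
  | cong_scaleAr k t u :
      alg_cong (TScale k (TMul t u)) (TMul t (TScale k u)).

HB.instance Definition _ := gen_eqMixin alg_term.
HB.instance Definition _ := gen_choiceMixin alg_term.

Definition alg_congb (t u : alg_term) : bool := `[< alg_cong t u >].

Fact alg_congb_refl : reflexive alg_congb.
Proof. by move=> t; apply/asboolP; apply: cong_refl. Qed.

Fact alg_congb_sym : symmetric alg_congb.
Proof. by move=> t u; apply/asboolP/asboolP; apply: cong_sym. Qed.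

Fact alg_congb_trans : transitive alg_congb.
Proof.
by move=> u t w /asboolP tu /asboolP uw; apply/asboolP; apply: cong_trans uw.
Qed.

Canonical alg_congb_equiv :=
  EquivRel alg_congb alg_congb_refl alg_congb_sym alg_congb_trans.

End Presentation.

Section Cohn.
Variables (K : fieldType) (E : finite_graph).

Inductive cohn_gen : Type :=
  | GVertex of vertex E
  | GEdge of edge E
  | GGhost of edge E.

Local Notation term := (alg_term K cohn_gen).
Local Notation V v := (TGen K (GVertex v)).
Local Notation D e := (TGen K (GEdge e)).
Local Notation G e := (TGen K (GGhost e)).

Inductive cohn_rel : term -> term -> Prop :=
  | rel_vv v w : cohn_rel (TMul (V v) (V w))
                          (if v == w then V w else TZero K cohn_gen)
  | rel_se e : cohn_rel (TMul (V (src e)) (D e)) (D e)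
  | rel_er e : cohn_rel (TMul (D e) (V (rng e))) (D e)
  | rel_rg e : cohn_rel (TMul (V (rng e)) (G e)) (G e)
  | rel_gs e : cohn_rel (TMul (G e) (V (src e))) (G e)
  | rel_ge e f : cohn_rel (TMul (G e) (D f))
                          (if e == f then V (rng e) else TZero K cohn_gen).

Local Notation cong := (alg_cong cohn_rel).

Definition cohn_algebra : Type := {eq_quot (alg_congb_equiv cohn_rel)}%qT.

HB.instance Definition _ := Choice.on cohn_algebra.
HB.instance Definition _ := EqQuotient.on cohn_algebra.

Definition cohn_class (t : term) : cohn_algebra := (\pi_cohn_algebra t)%qT.
Local Notation cl := cohn_class.

Lemma cohn_classP (t u : term) : cl t = cl u <-> cong t u.
Proof.
rewrite /cohn_class; split=> [/eqmodP /asboolP //|tu].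
by apply/eqmodP/asboolP.
Qed.

Lemma cohn_classW (P : cohn_algebra -> Prop) :
  (forall t, P (cl t)) -> forall x, P x.
Proof. by move=> Pcl; apply: quotW => t; apply: Pcl. Qed.

Lemma cohn_repr (t : term) : cong (repr (cl t)) t.
Proof. by apply/cohn_classP; rewrite /cohn_class reprK. Qed.

Definition cohn_zero : cohn_algebra := cl (TZero K cohn_gen).
Definition cohn_opp (x : cohn_algebra) : cohn_algebra := cl (TOpp (repr x)).
Definition cohn_add (x y : cohn_algebra) : cohn_algebra :=
  cl (TAdd (repr x) (repr y)).
Definition cohn_mul (x y : cohn_algebra) : cohn_algebra :=
  cl (TMul (repr x) (repr y)).
Definition cohn_scale (k : K) (x : cohn_algebra) : cohn_algebra :=
  cl (TScale k (repr x)).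

Lemma cohn_oppE t : cohn_opp (cl t) = cl (TOpp t).
Proof. by apply/cohn_classP; apply: cong_opp; apply: cohn_repr. Qed.
Lemma cohn_addE t u : cohn_add (cl t) (cl u) = cl (TAdd t u).
Proof. by apply/cohn_classP; apply: cong_add; apply: cohn_repr. Qed.
Lemma cohn_mulE t u : cohn_mul (cl t) (cl u) = cl (TMul t u).
Proof. by apply/cohn_classP; apply: cong_mul; apply: cohn_repr. Qed.
Lemma cohn_scaleE k t : cohn_scale k (cl t) = cl (TScale k t).
Proof. by apply/cohn_classP; apply: cong_scale; apply: cohn_repr. Qed.

Fact cohn_addA : associative cohn_add.
Proof.
elim/cohn_classW=> t; elim/cohn_classW=> u; elim/cohn_classW=> w.
by rewrite !cohn_addE; apply/cohn_classP; apply: cong_addA.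
Qed.

Fact cohn_addC : commutative cohn_add.
Proof.
elim/cohn_classW=> t; elim/cohn_classW=> u.
by rewrite !cohn_addE; apply/cohn_classP; apply: cong_addC.
Qed.

Fact cohn_add0 : left_id cohn_zero cohn_add.
Proof.
elim/cohn_classW=> t.
by rewrite cohn_addE; apply/cohn_classP; apply: cong_add0.
Qed.

Fact cohn_addN : left_inverse cohn_zero cohn_opp cohn_add.
Proof.
elim/cohn_classW=> t.
by rewrite cohn_oppE cohn_addE; apply/cohn_classP; apply: cong_addN.
Qed.

HB.instance Definition _ :=
  GRing.isZmodule.Build cohn_algebra cohn_addA cohn_addC cohn_add0 cohn_addN.

Definition cohn_vertex (v : vertex E) : cohn_algebra := cl (V v).
Definition cohn_edge (e : edge E) : cohn_algebra := cl (D e).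
Definition cohn_ghost (e : edge E) : cohn_algebra := cl (G e).

Definition cohn_one : cohn_algebra := \sum_v cohn_vertex v.

Fact cohn_mulA : associative cohn_mul.
Proof.
elim/cohn_classW=> t; elim/cohn_classW=> u; elim/cohn_classW=> w.
by rewrite !cohn_mulE; apply/cohn_classP; apply: cong_mulA.
Qed.

Fact cohn_mulDl : left_distributive cohn_mul +%R.
Proof.
elim/cohn_classW=> t; elim/cohn_classW=> u; elim/cohn_classW=> w.
rewrite /GRing.add /= !(cohn_mulE, cohn_addE).
by apply/cohn_classP; apply: cong_mulDl.
Qed.

Fact cohn_mulDr : right_distributive cohn_mul +%R.
Proof.
elim/cohn_classW=> t; elim/cohn_classW=> u; elim/cohn_classW=> w.
rewrite /GRing.add /= !(cohn_mulE, cohn_addE).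
by apply/cohn_classP; apply: cong_mulDr.
Qed.

Fact cohn_scaleA k l x : cohn_scale k (cohn_scale l x) = cohn_scale (k * l) x.
Proof.
elim/cohn_classW: x => t; rewrite !cohn_scaleE.
by apply/cohn_classP; apply: cong_scaleA.
Qed.

Fact cohn_scale1 : left_id 1 cohn_scale.
Proof.
elim/cohn_classW=> t; rewrite cohn_scaleE.
by apply/cohn_classP; apply: cong_scale1.
Qed.

Fact cohn_scaleDr : right_distributive cohn_scale +%R.
Proof.
move=> k; elim/cohn_classW=> t; elim/cohn_classW=> u.
rewrite /GRing.add /= !(cohn_scaleE, cohn_addE).
by apply/cohn_classP; apply: cong_scaleDr.
Qed.

Fact cohn_scaleDl x : {morph cohn_scale^~ x : k l / k + l}.
Proof.
elim/cohn_classW: x => t k l.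
rewrite [RHS]/GRing.add /= !(cohn_scaleE, cohn_addE).
by apply/cohn_classP; apply: cong_scaleDl.
Qed.

Fact cohn_scaleAl k x y : cohn_scale k (cohn_mul x y) = cohn_mul (cohn_scale k x) y.
Proof.
elim/cohn_classW: x => t; elim/cohn_classW: y => u.
rewrite !(cohn_scaleE, cohn_mulE).
by apply/cohn_classP; apply: cong_scaleAl.
Qed.

Fact cohn_scaleAr k x y : cohn_scale k (cohn_mul x y) = cohn_mul x (cohn_scale k y).
Proof.
elim/cohn_classW: x => t; elim/cohn_classW: y => u.
rewrite !(cohn_scaleE, cohn_mulE).
by apply/cohn_classP; apply: cong_scaleAr.
Qed.

HB.instance Definition _ := GRing.Zmodule_isLmodule.Build K cohn_algebra
  cohn_scaleA cohn_scale1 cohn_scaleDr cohn_scaleDl.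

Fact cohn_mul0l x : cohn_mul 0 x = 0.
Proof. by apply: (addIr (cohn_mul 0 x)); rewrite -cohn_mulDl !add0r. Qed.

Fact cohn_mul0r x : cohn_mul x 0 = 0.
Proof. by apply: (addIr (cohn_mul x 0)); rewrite -cohn_mulDr !add0r. Qed.

Fact cohn_mul_suml x (F : vertex E -> cohn_algebra) :
  cohn_mul (\sum_v F v) x = \sum_v cohn_mul (F v) x.
Proof.
by apply: (big_morph (cohn_mul^~ x)) => [y z|]; rewrite (cohn_mulDl, cohn_mul0l).
Qed.

Fact cohn_mul_sumr x (F : vertex E -> cohn_algebra) :
  cohn_mul x (\sum_v F v) = \sum_v cohn_mul x (F v).
Proof.
by apply: (big_morph (cohn_mul x)) => [y z|]; rewrite (cohn_mulDr, cohn_mul0r).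
Qed.

Fact cohn_mul_vv v w :
  cohn_mul (cohn_vertex v) (cohn_vertex w) = if v == w then cohn_vertex w else 0.
Proof.
rewrite cohn_mulE (_ : (if _ then _ else _) =
  cl (if v == w then V w else TZero K cohn_gen)); last by case: ifP.
by apply/cohn_classP/cong_rel/rel_vv.
Qed.

Fact cohn_mul_se e : cohn_mul (cohn_vertex (src e)) (cohn_edge e) = cohn_edge e.
Proof. by rewrite cohn_mulE; apply/cohn_classP/cong_rel/rel_se. Qed.

Fact cohn_mul_er e : cohn_mul (cohn_edge e) (cohn_vertex (rng e)) = cohn_edge e.
Proof. by rewrite cohn_mulE; apply/cohn_classP/cong_rel/rel_er. Qed.

Fact cohn_mul_rg e :
  cohn_mul (cohn_vertex (rng e)) (cohn_ghost e) = cohn_ghost e.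
Proof. by rewrite cohn_mulE; apply/cohn_classP/cong_rel/rel_rg. Qed.

Fact cohn_mul_gs e :
  cohn_mul (cohn_ghost e) (cohn_vertex (src e)) = cohn_ghost e.
Proof. by rewrite cohn_mulE; apply/cohn_classP/cong_rel/rel_gs. Qed.

Fact cohn_mul_ge e f :
  cohn_mul (cohn_ghost e) (cohn_edge f) =
  if e == f then cohn_vertex (rng e) else 0.
Proof.
rewrite cohn_mulE (_ : (if _ then _ else _) =
  cl (if e == f then V (rng e) else TZero K cohn_gen)); last by case: ifP.
by apply/cohn_classP/cong_rel/rel_ge.
Qed.

Fact cohn_mul_1vertex v : cohn_mul cohn_one (cohn_vertex v) = cohn_vertex v.
Proof.
rewrite cohn_mul_suml (bigD1 v) //= cohn_mul_vv eqxx big1 ?addr0 // => w wv.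
by rewrite cohn_mul_vv (negbTE wv).
Qed.

Fact cohn_mul_vertex1 v : cohn_mul (cohn_vertex v) cohn_one = cohn_vertex v.
Proof.
rewrite cohn_mul_sumr (bigD1 v) //= cohn_mul_vv eqxx big1 ?addr0 // => w wv.
by rewrite cohn_mul_vv eq_sym (negbTE wv).
Qed.

Fact cohn_mul1 : left_id cohn_one cohn_mul.
Proof.
elim/cohn_classW; elim=> [[v|e|e]||t IHt|t IHt u IHu|t IHt u _|k t IHt].
- exact: cohn_mul_1vertex.
- by rewrite -/(cohn_edge e) -cohn_mul_se cohn_mulA cohn_mul_1vertex.
- by rewrite -/(cohn_ghost e) -cohn_mul_rg cohn_mulA cohn_mul_1vertex.
- exact: cohn_mul0r.
- rewrite -cohn_oppE; apply: (addIr (cl t)); rewrite -{2}IHt -cohn_mulDr.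
  by rewrite [_ + cl t]cohn_addN cohn_mul0r.
- by rewrite -cohn_addE [LHS]cohn_mulDr IHt IHu.
- by rewrite -cohn_mulE cohn_mulA IHt.
- by rewrite -cohn_scaleE -cohn_scaleAr IHt.
Qed.

Fact cohn_mulr1 : right_id cohn_one cohn_mul.
Proof.
elim/cohn_classW; elim=> [[v|e|e]||t IHt|t IHt u IHu|t _ u IHu|k t IHt].
- exact: cohn_mul_vertex1.
- by rewrite -/(cohn_edge e) -cohn_mul_er -cohn_mulA cohn_mul_vertex1.
- by rewrite -/(cohn_ghost e) -cohn_mul_gs -cohn_mulA cohn_mul_vertex1.
- exact: cohn_mul0l.
- rewrite -cohn_oppE; apply: (addIr (cl t)); rewrite -{2}IHt -cohn_mulDl.
  by rewrite [_ + cl t]cohn_addN cohn_mul0l.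
- by rewrite -cohn_addE [LHS]cohn_mulDl IHt IHu.
- by rewrite -cohn_mulE -cohn_mulA IHu.
- by rewrite -cohn_scaleE -cohn_scaleAl IHt.
Qed.

(* To see that 1 is nonzero, let the algebra act on the K-valued functions on
   pairs (p, v), thought of as a path p ending at v. *)
Local Notation path_type := (seq (edge E) * vertex E)%type.
Local Notation path_fun := (path_type -> K).

Definition path_src (p : path_type) : vertex E :=
  if p.1 is e :: _ then src e else p.2.

Definition gen_act (g : cohn_gen) (f : path_fun) (p : path_type) : K :=
  match g with
  | GVertex v => if path_src p == v then f p else 0
  | GEdge e =>
      if p.1 is e' :: q then
        if (e' == e) && (path_src (q, p.2) == rng e) then f (q, p.2) else 0
      else 0
  | GGhost e => if path_src p == rng e then f (e :: p.1, p.2) else 0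
  end.

Fixpoint term_act (t : term) (f : path_fun) : path_fun :=
  match t with
  | TGen g => gen_act g f
  | TZero => fun=> 0
  | TOpp u => fun p => - term_act u f p
  | TAdd u w => fun p => term_act u f p + term_act w f p
  | TMul u w => term_act u (term_act w f)
  | TScale k u => fun p => k * term_act u f p
  end.

Fact term_actP t (a : K) (f g : path_fun) (p : path_type) :
  term_act t (fun q => a * f q + g q) p = a * term_act t f p + term_act t g p.
Proof.
elim: t f g p => [[v|e|e]||t IHt|t IHt u IHu|t IHt u IHu|k t IHt] f g [p w] /=.
- by case: ifP => _; rewrite ?mulr0 ?addr0.
- by case: p => [|e' q] /=; [|case: ifP => _]; rewrite ?mulr0 ?addr0.
- by case: ifP => _; rewrite ?mulr0 ?addr0.
- by rewrite mulr0 addr0.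
- by rewrite IHt opprD mulrN.
- by rewrite IHt IHu mulrDr addrACA.
- rewrite -IHt; congr term_act; apply/funext => q; exact: IHu.
- by rewrite IHt mulrDr mulrCA.
Qed.

Fact term_act_cong t u : cong t u -> term_act t = term_act u.
Proof.
have addP s f g : term_act s (fun q => f q + g q) =
    (fun q => term_act s f q + term_act s g q).
  apply/funext => p; have := term_actP s 1 f g p; rewrite mul1r => <-.
  by congr (term_act s _ p); apply/funext => q; rewrite mul1r.
have act0 s : term_act s (fun=> 0) = fun=> 0.
  apply/funext => p.
  rewrite -[RHS](addNr (term_act s (fun=> 0) p)) -mulN1r -term_actP.
  by congr (term_act s _ p); apply/funext => q; rewrite mulr0 addr0.
have scaleP s k f : term_act s (fun q => k * f q) =
    (fun q => k * term_act s f q).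
  apply/funext => p; have := term_actP s k f (fun=> 0) p.
  rewrite act0 addr0 => <-.
  by congr (term_act s _ p); apply/funext => q; rewrite addr0.
elim=> {t u}.
- move=> t u [v w|e|e|e|e|e e']; apply/funext => f; apply/funext => -[p x] /=.
  + have [->|vw] := eqVneq v w; first by case: ifP => //= ->.
    case: ifP => //= /eqP pv; case: ifP => // /eqP pw.
    by rewrite -pv -pw eqxx in vw.
  + case: p => [|e' q] /=; first by case: ifP.
    by rewrite /path_src /=; case: (eqVneq e' e) => [->|_] /=; rewrite ?eqxx // if_same.
  + by case: p => [|e' q] //=; case: ifP => // /andP[_ ->].
  + by case: ifP => // ->.
  + by rewrite /path_src /= eqxx.
  + have [<-|ee] := eqVneq e e' => /=.
      by case: ifP => // ->.
    by rewrite if_same.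
- by [].
- by move=> t u _ ->.
- by move=> u t w _ -> _ ->.
- by move=> t t' _ /= ->.
- by move=> t t' u u' _ /= -> _ ->.
- by move=> t t' u u' _ /= -> _ ->.
- by move=> k t t' _ /= ->.
all: intros; apply/funext => f; apply/funext => p //=.
- by rewrite addrA.
- by rewrite addrC.
- by rewrite add0r.
- by rewrite addNr.
- by rewrite addP.
- by rewrite mulrA.
- by rewrite mul1r.
- by rewrite mulrDr.
- by rewrite mulrDl.
- by rewrite scaleP.
Qed.

Fact cohn_one_neq0 : cohn_one != 0.
Proof.
have /card_gt0P[v _] := vertex_gt0 E.
apply/eqP => one0; have : cohn_vertex v = 0.
  by rewrite -(cohn_mul1 (cohn_vertex v)) one0 cohn_mul0l.
move/cohn_classP/term_act_cong/(congr1 (fun F => F (fun=> 1) ([::], v))).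
by rewrite /= /path_src eqxx => /eqP; rewrite oner_eq0.
Qed.

HB.instance Definition _ := GRing.Zmodule_isNzRing.Build cohn_algebra
  cohn_mulA cohn_mul1 cohn_mulr1 cohn_mulDl cohn_mulDr cohn_one_neq0.
HB.instance Definition _ :=
  GRing.Lmodule_isLalgebra.Build K cohn_algebra cohn_scaleAl.
HB.instance Definition _ :=
  GRing.Lalgebra_isAlgebra.Build K cohn_algebra cohn_scaleAr.

Fixpoint term_eval (A : algType K) (h : cohn_gen -> A) (t : term) : A :=
  match t with
  | TGen g => h g
  | TZero => 0
  | TOpp u => - term_eval h u
  | TAdd u w => term_eval h u + term_eval h w
  | TMul u w => term_eval h u * term_eval h w
  | TScale k u => k *: term_eval h u
  end.

Definition satisfies_cohn_relations (A : algType K) (h : cohn_gen -> A) : Prop :=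
  [/\ forall v w, h (GVertex v) * h (GVertex w) =
                  if v == w then h (GVertex w) else 0,
      forall e, h (GVertex (src e)) * h (GEdge e) = h (GEdge e) /\
                h (GEdge e) * h (GVertex (rng e)) = h (GEdge e),
      forall e, h (GVertex (rng e)) * h (GGhost e) = h (GGhost e) /\
                h (GGhost e) * h (GVertex (src e)) = h (GGhost e)
    & forall e f, h (GGhost e) * h (GEdge f) =
                  if e == f then h (GVertex (rng e)) else 0].

Definition cohn_generator (g : cohn_gen) : cohn_algebra := cl (TGen K g).

Lemma cohn_generatorP : satisfies_cohn_relations cohn_generator.
Proof.
split=> [v w|e|e|e f].
- exact: cohn_mul_vv.
- by split; [exact: cohn_mul_se | exact: cohn_mul_er].
- by split; [exact: cohn_mul_rg | exact: cohn_mul_gs].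
- exact: cohn_mul_ge.
Qed.

Lemma term_eval_cong (A : algType K) (h : cohn_gen -> A) :
  satisfies_cohn_relations h ->
  forall t u, cong t u -> term_eval h t = term_eval h u.
Proof.
move=> [hv he hg hge] t u; elim=> {t u}.
- move=> t u [v w|e|e|e|e|e f] /=.
  + by rewrite hv; case: ifP.
  + by case: (he e).
  + by case: (he e).
  + by case: (hg e).
  + by case: (hg e).
  + by rewrite hge; case: ifP.
- by [].
- by move=> t u _ ->.
- by move=> u t w _ -> _ ->.
- by move=> t t' _ /= ->.
- by move=> t t' u u' _ /= -> _ ->.
- by move=> t t' u u' _ /= -> _ ->.
- by move=> k t t' _ /= ->.
- by move=> t u w /=; rewrite addrA.
- by move=> t u /=; rewrite addrC.
- by move=> t /=; rewrite add0r.
- by move=> t /=; rewrite addNr.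
- by move=> t u w /=; rewrite mulrA.
- by move=> t u w /=; rewrite mulrDl.
- by move=> t u w /=; rewrite mulrDr.
- by move=> k l t /=; rewrite scalerA.
- by move=> t /=; rewrite scale1r.
- by move=> k t u /=; rewrite scalerDr.
- by move=> k l t /=; rewrite scalerDl.
- by move=> k t u /=; rewrite scalerAl.
- by move=> k t u /=; rewrite scalerAr.
Qed.

(* The universal property of the presentation. *)
Lemma cohn_universal (A : algType K) (h : cohn_gen -> A) :
  satisfies_cohn_relations h ->
  exists! f : cohn_algebra -> A,
    [/\ linear f, {morph f : x y / x * y} & forall g, f (cohn_generator g) = h g].
Proof.
move=> hP; pose f (x : cohn_algebra) := term_eval h (repr x).
have fE t : f (cl t) = term_eval h t by exact/(term_eval_cong hP)/cohn_repr.
exists f; split.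
  split=> [k||g]; last exact: fE.
  - elim/cohn_classW=> t; elim/cohn_classW=> u.
    have -> : k *: cl t + cl u = cl (TAdd (TScale k t) u).
      by rewrite -cohn_addE -cohn_scaleE.
    by rewrite !fE.
  - elim/cohn_classW=> t; elim/cohn_classW=> u.
    have -> : cl t * cl u = cl (TMul t u) by exact: cohn_mulE.
    by rewrite !fE.
move=> f' [f'lin f'mul f'gen].
have f'D x y : f' (x + y) = f' x + f' y.
  by rewrite -[in LHS](scale1r x) f'lin scale1r.
have f'0 : f' 0 = 0 by apply: (addIr (f' 0)); rewrite -f'D !add0r.
have f'Z k x : f' (k *: x) = k *: f' x by rewrite -[k *: x]addr0 f'lin f'0 addr0.
have f'N x : f' (- x) = - f' x by rewrite -scaleN1r f'Z scaleN1r.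
apply/funext; elim/cohn_classW=> t; rewrite fE.
elim: t => [g||t IHt|t IHt u IHu|t IHt u IHu|k t IHt] /=.
- by rewrite -f'gen.
- exact: esym f'0.
- by rewrite -cohn_oppE [RHS]f'N IHt.
- by rewrite -cohn_addE [RHS]f'D IHt IHu.
- by rewrite -cohn_mulE [RHS]f'mul IHt IHu.
- by rewrite -cohn_scaleE [RHS]f'Z IHt.
Qed.

End Cohn.

(* Main.v *)
(* If every vertex has an incoming edge and there is no source cycle, tracing
   edges backwards from any vertex meets a vertex of in-degree at least 2;
   hence for some N each vertex v is the range of two distinct paths mu_1(v),
   mu_2(v) of length N.  Distinct paths of equal length are orthogonal
   (mu^* nu = 0), so x_i = sum_v mu_i(v) and y_i = sum_v mu_i(v)^* satisfy
   y_i x_j = delta_ij, and the single vector (y_1, y_2) generates R^2.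
   Conversely, let S be {v} for a source v, or the vertex set of a source cycle.
   Sending v to E_{v,v}, e to E_{s(e),r(e)} and e^* to E_{r(e),s(e)}, where
   matrix units outside S x S are read as 0, is a unital homomorphism from
   C_K(E) to the S x S matrices over K, and UGN is reflected by homomorphisms. *)
Require Import Defs.
From mathcomp Require Import all_boot all_order all_algebra.
From HB Require Import structures.
From mathcomp Require Import boolp classical_sets cardinality.

Set Implicit Arguments.
Unset Strict Implicit.
Unset Printing Implicit Defensive.

Import GRing.Theory.

Local Open Scope ring_scope.

(** * Generating sets, and criteria for and against UGN *)

Lemma generating_ordinal (A : nzRingType) (M : lmodType A) (S : set M) (n : nat) :
  generating S -> (S #= `I_n)%card ->
  exists s : 'I_n -> M, forall x, exists c : 'I_n -> A,
    x = \sum_(j < n) c j *: s j.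
Proof.
move=> genS /card_set_bijP[f [fS finj fsurj]].
have /choice[s sP] : forall j : 'I_n, exists a, S a /\ f a = j.
  by move=> j; have [a Sa fa] := fsurj j (ltn_ord j); exists a.
exists s => x; have [l [g [c [gS ->]]]] := genS x.
pose t k := Ordinal (fS _ (gS k)).
have st k : s (t k) = g k.
  by have [? ?] := sP (t k); apply: finj; rewrite ?inE.
(* Several indices k may name the same element of S, so their coefficients are added. *)
exists (fun j => \sum_(k < l | t k == j) c k).
rewrite (partition_big t predT) //=; apply: eq_bigr => j _.
by rewrite scaler_suml; apply: eq_bigr => k /eqP <-; rewrite st.
Qed.

(* The products below are in R: generation over R^c reverses them, so the
   generators appear on the left of their coefficients. *)
Lemma ugn_of_left_inverse_bound (R : nzRingType) :
  (forall m n (Y : 'I_m -> 'I_n -> R) (X : 'I_n -> 'I_m -> R),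
     (forall i k, \sum_j Y i j * X j k = (i == k)%:R) -> (m <= n)%N) ->
  unbounded_generating_number R.
Proof.
move=> bound m m_gt0 S genS.
have [[n Sn]|/infiniteP Sinf] := pselect (finite_set S); last first.
  by apply: card_le_trans Sinf; apply/subset_card_le.
rewrite (card_le_eqr Sn) card_le_II.
have [s s_gen] := generating_ordinal genS Sn.
(* The entries of the generators form Y; the coordinates of the standard basis vectors form X. *)
have /choice[c cP] k := s_gen (delta_mx 0 k).
apply: (bound _ _ (fun i j => s j 0 i) (fun j k => c k j)) => i k.
have /(congr1 (fun u : 'rV__ => u 0 i)) := cP k.
rewrite mxE eqxx /= => ->; rewrite summxE.
by apply: eq_bigr => j _; rewrite mxE.
Qed.

(** Through [phi], X acts as a K-linear map from m to n copies of the matrix algebra, and Y provides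
    a left inverse. Comparing dimensions over K gives m <= n. *)
Lemma ugn_of_matrix_rep (R : nzRingType) (K : fieldType) (d : nat)
    (phi : {rmorphism R -> 'M[K]_d.+1}) :
  unbounded_generating_number R.
Proof.
apply: ugn_of_left_inverse_bound => m n Y X YX.
pose F (u : {ffun 'I_m -> 'M[K]_d.+1}) : {ffun 'I_n -> 'M[K]_d.+1} :=
  [ffun j => \sum_i phi (X j i) * u i].
have F_lin : linear F.
  move=> a u v; apply/ffunP => j; rewrite !ffunE scaler_sumr -big_split.
  by apply: eq_bigr => i _; rewrite !ffunE mulrDr scalerAr.
pose F' : {linear _ -> _} := HB.pack F (GRing.isLinear.Build _ _ _ _ F F_lin).
have F_inj : injective F.
  pose G (w : {ffun 'I_n -> 'M[K]_d.+1}) : {ffun 'I_m -> 'M[K]_d.+1} :=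
    [ffun i => \sum_j phi (Y i j) * w j].
  apply: (can_inj (g := G)) => u; apply/ffunP => i; rewrite ffunE.
  under eq_bigr do rewrite ffunE mulr_sumr.
  rewrite exchange_big /= (bigD1 i) //= [X in _ + X]big1 ?addr0.
    under eq_bigr do rewrite mulrA -rmorphM.
    by rewrite -mulr_suml -rmorph_sum YX eqxx rmorph1 mul1r.
  move=> k ki; under eq_bigr do rewrite mulrA -rmorphM.
  by rewrite -mulr_suml -rmorph_sum YX eq_sym (negbTE ki) rmorph0 mul0r.
have /lker0P/eqP ker0 : injective (linfun F').
  by move=> u v; rewrite !lfunE => /F_inj.
have := dimvS (subvf (limg (linfun F'))).
rewrite limg_dim_eq ?ker0 ?capv0 // !dimvf /dim /= !card_ord.
by rewrite leq_pmul2r ?muln_gt0.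
Qed.

Lemma orthonormal_not_ugn (R : nzRingType) (m : nat) (x y : 'I_m -> R) :
  (1 < m)%N -> (forall i j, y i * x j = (i == j)%:R) ->
  ~ unbounded_generating_number R.
Proof.
move=> m_gt1 yx ugn.
pose g : 'rV[R^c]_m := \row_i (y i : R^c).
suff gen : generating [set g]%classic.
  have /(card_le_trans (ugn m (ltnW m_gt1) _ gen)) : ([set g]%classic #<= `I_1)%card.
    have -> : [set g]%classic = ((fun=> g) @` `I_1)%classic by rewrite II1 image_set1.
    exact: card_image_le.
  by rewrite card_le_II leqNgt m_gt1.
move=> a; exists 1%N, (fun=> g), (fun=> \sum_j x j * a 0 j); split=> //.
apply/rowP => i; rewrite big_ord1 !mxE.
(* Scaling by c over [R^c] is right multiplication by c in R. *)
rewrite [RHS](_ : _ = y i * (\sum_j x j * a 0 j) :> R) // mulr_sumr.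
rewrite (bigD1 i) //= mulrA yx eqxx mul1r big1 ?addr0 // => j ji.
by rewrite mulrA yx eq_sym (negbTE ji) mul0r.
Qed.

(** * Matrix representations of the Cohn algebra *)

Section MatrixRepresentation.
Variables (K : fieldType) (E : finite_graph) (S : {set vertex E}).
Hypothesis S_neq0 : S != finset.set0.
(** This and [S_inj] serve the relation for a ghost e times an edge f: closure keeps the inner index
    [src e] in S when e = f, and injectivity makes the product vanish when e and f differ but share
    a source. *)
Hypothesis S_closed : forall e, rng e \in S -> src e \in S.
Hypothesis S_inj : forall e f : edge E,
  rng e \in S -> rng f \in S -> src e = src f -> e = f.

Let d := #|S|.-1.
Let dE : #|S| = d.+1. Proof. by rewrite prednK // card_gt0. Qed.
Let at_ (i : 'I_d.+1) : vertex E := enum_val (cast_ord (esym dE) i).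

Let at_inj : injective at_.
Proof. by move=> i j /enum_val_inj/cast_ord_inj. Qed.

Let at_surj v : v \in S -> exists i, at_ i = v.
Proof.
move=> vS; exists (cast_ord dE (enum_rank_in vS v)).
by rewrite /at_ cast_ordK enum_rankK_in.
Qed.

Let unit_mx (v w : vertex E) : 'M[K]_d.+1 :=
  \matrix_(i, j) ((at_ i == v) && (at_ j == w))%:R.

Let unit_mxM v w v' w' :
  unit_mx v w * unit_mx v' w' =
  if (w == v') && (w \in S) then unit_mx v w' else 0.
Proof.
apply/matrixP => i k; rewrite !mxE; case: ifP => [/andP[/eqP<- /at_surj[j jw]]|wv].
  rewrite (bigD1 j) //= !mxE jw eqxx big1 => [|j' j'j].
    by rewrite addr0 andbT -natrM mulnb.
  by rewrite !mxE -jw (inj_eq at_inj) (negbTE j'j) andbF mul0r.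
rewrite !mxE big1 // => j _; rewrite !mxE -natrM mulnb.
case: eqP => //= _; case: eqP => //= jw; case: eqP => //= jv.
by rewrite -jw -jv eqxx enum_valP in wv.
Qed.

Let unit_mx_out v w : (v \notin S) || (w \notin S) -> unit_mx v w = 0.
Proof.
move=> vw; apply/matrixP => i j; rewrite !mxE.
case: eqP vw => //= <-; case: eqP => //= <-.
by rewrite !enum_valP.
Qed.

Let rep_gen (g : cohn_gen E) : 'M[K]_d.+1 :=
  match g with
  | GVertex v => unit_mx v v
  | GEdge e => unit_mx (src e) (rng e)
  | GGhost e => unit_mx (rng e) (src e)
  end.

Let rep_genP : satisfies_cohn_relations rep_gen.
Proof.
have out v w : (if v \in S then unit_mx v w else 0) = unit_mx v w.
  by case: ifPn => // vS; rewrite unit_mx_out ?vS.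
have out' v w : (if w \in S then unit_mx v w else 0) = unit_mx v w.
  by case: ifPn => // wS; rewrite unit_mx_out ?wS ?orbT.
split=> [v w|e|e|e f] /=; rewrite !unit_mxM ?eqxx /= ?out ?out' //.
  by case: eqP => //= ->; rewrite out.
have [<-|ef] := eqVneq e f.
  rewrite eqxx /=; case: ifPn => // /(contra (@S_closed e)) re.
  by rewrite unit_mx_out ?re.
case: ifP => // /andP[/eqP sef _].
have [re|re] := boolP (rng e \in S); last by rewrite unit_mx_out ?re.
have [rf|rf] := boolP (rng f \in S); last by rewrite unit_mx_out ?rf ?orbT.
by rewrite (S_inj re rf sef) eqxx in ef.
Qed.

Lemma cohn_ugn_of_backward_closed : unbounded_generating_number (cohn_algebra K E).
Proof.
have [phi [[phi_lin phiM phi_gen] _]] := cohn_universal rep_genP.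
pose phiL : {linear _ -> _} := HB.pack phi (GRing.isLinear.Build _ _ _ _ phi phi_lin).
(* The universal property concerns non-unital maps, so unitality is checked: the diagonal units over
   S sum to 1. *)
have phi1 : phi 1 = 1.
  rewrite -[phi]/(phiL : _ -> _) linear_sum /=.
  under eq_bigr => v _ do rewrite (phi_gen (GVertex v)).
  apply/matrixP => i j; rewrite summxE (bigD1 (at_ i)) //= big1 => [|v vi].
    by rewrite addr0 !mxE eqxx /= (inj_eq at_inj) eq_sym.
  by rewrite mxE eq_sym (negbTE vi).
pose phiR : {rmorphism cohn_algebra K E -> 'M[K]_d.+1} :=
  HB.pack phi (GRing.Linear.on phiL)
    (GRing.isMonoidMorphism.Build _ _ phi (conj phi1 phiM)).
exact: ugn_of_matrix_rep phiR.
Qed.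

End MatrixRepresentation.

(** * Orthogonality of paths, and tracing edges backwards *)

Section Paths.
Variable E : finite_graph.
Implicit Types (v w : vertex E) (e : edge E) (p q : seq (edge E)).

(** The endpoint v is kept apart from the edge list so that each vertex has its own empty path. *)
Fixpoint path_to v p : bool :=
  if p is e :: q then (rng e == path_src (q, v)) && path_to v q else true.

Section PathElements.
Variable K : fieldType.

Definition path_elt v p : cohn_algebra K E :=
  foldr (fun e x => cohn_edge K e * x) (cohn_vertex K v) p.

(** The adjoint of [path_elt v p]: ghosts accumulate on the right, in reverse order. *)
Definition ghost_elt v p : cohn_algebra K E :=
  foldr (fun e x => x * cohn_ghost K e) (cohn_vertex K v) p.

Lemma vertex_path_elt v p :
  cohn_vertex K (path_src (p, v)) * path_elt v p = path_elt v p.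
Proof.
case: p => [|e p] /=; first by have := cohn_mul_vv K v v; rewrite eqxx.
by rewrite mulrA; congr (_ * _); apply: cohn_mul_se.
Qed.

(** The innermost product of a ghost and an edge is 0 or a vertex, which the rest of q absorbs;
    induction applies to the shorter paths. *)
Lemma ghost_path_elt v w p q :
  size p = size q -> path_to w q ->
  ghost_elt v p * path_elt w q =
  if (p == q) && (v == w) then cohn_vertex K w else 0.
Proof.
elim: p q => [|e p IHp] [|f q] //=; first by move=> _ _; apply: cohn_mul_vv.
move=> [spq] /andP[/eqP fq qw]; rewrite mulrA -[_ * _ * cohn_edge K f]mulrA.
have -> : cohn_ghost K e * cohn_edge K f =
  if e == f then cohn_vertex K (rng e) else 0 by apply: cohn_mul_ge.
rewrite eqseq_cons; case: eqP => [->|] /=; last by rewrite mulr0 mul0r.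
by rewrite -mulrA fq vertex_path_elt IHp.
Qed.

Lemma distinct_paths_not_ugn (m N : nat) (mu : 'I_m -> vertex E -> seq (edge E)) :
  (1 < m)%N ->
  (forall i v, size (mu i v) = N) -> (forall i v, path_to v (mu i v)) ->
  (forall v, injective (mu^~ v)) ->
  ~ unbounded_generating_number (cohn_algebra K E).
Proof.
move=> m_gt1 size_mu mu_to mu_inj.
apply: (@orthonormal_not_ugn _ m (fun i => \sum_v path_elt v (mu i v))
          (fun i => \sum_v ghost_elt v (mu i v))) => // i j.
have one_sum : (1 : cohn_algebra K E) = \sum_v cohn_vertex K v by [].
rewrite -[RHS]mulr1 one_sum mulr_suml mulr_sumr.
apply: eq_bigr => v _; rewrite mulr_sumr (bigD1 v) //= big1 ?addr0 => [|w wv].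
  rewrite ghost_path_elt ?size_mu // (inj_eq (mu_inj v)) eqxx andbT.
  by case: ifP; rewrite ?mul1r ?mul0r.
by rewrite ghost_path_elt ?size_mu // [v == w]eq_sym (negbTE wv) andbF.
Qed.

End PathElements.

Section NoSource.
Variable inc : vertex E -> edge E.
Hypothesis rng_inc : forall v, rng (inc v) = v.

Lemma path_to_extend v p n : path_to v p ->
  exists r, size r = n /\ path_to v (r ++ p).
Proof.
move=> pv; elim: n => [|n [r [sr rpv]]]; first by exists [::].
exists (inc (path_src (r ++ p, v)) :: r).
by rewrite /= sr rng_inc eqxx rpv.
Qed.

Let prev v := src (inc v).

(* A point of minimal order in the backward orbit of v is periodic. *)
Lemma source_cycle_of_indegree1 v :
  (forall w, fconnect prev v w -> #|[set e : edge E | rng e == w]| == 1%N) ->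
  exists c : seq (edge E), is_source_cycle c.
Proof.
move=> indeg1.
have [x vx min_x] := arg_minnP (order prev) (connect0 (frel prev) v).
have orb w : w \in orbit prev x -> fconnect prev v w.
  by rewrite -fconnect_orbit; apply: connect_trans.
(* Off a cycle, a step of [prev] would lower the order by one, against minimality. *)
have x_cyc : fcycle prev (orbit prev x).
  case: (orderPcycle prev x) => // _ order_x.
  have := min_x _ (connect_trans vx (fconnect1 _ x)).
  by rewrite order_x ltnn.
have prev_inj : {in orbit prev x &, injective prev}.
  exact/(orbitPcycle 0 5).
(* The orbit runs against the edges, hence the reversal. *)
exists (rev (map inc (orbit prev x))); rewrite /is_source_cycle /is_cycle.
rewrite /is_closed_path rev_cycle map_rev rev_uniq -map_comp all_rev.
rewrite -size_eq0 size_rev size_map size_orbit -lt0n order_gt0 /=.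
apply/andP; split; first (apply/andP; split).
- rewrite cycle_map; apply: sub_cycle x_cyc => a b /= /eqP <-.
  by rewrite rng_inc.
- by rewrite map_inj_in_uniq ?orbit_uniq.
- apply/allP => _ /mapP[w xw ->]; apply: indeg1.
  exact: connect_trans (orb w xw) (fconnect1 _ w).
Qed.

Lemma path_to_of_fconnect v w : fconnect prev v w ->
  exists p, path_to v p /\ path_src (p, v) = w.
Proof.
move/iter_findex <-; elim: (findex _ _ _) => [|k [p [pv pk]]].
  by exists [::].
by exists (inc (path_src (p, v)) :: p); rewrite /= rng_inc eqxx pk.
Qed.

Lemma two_paths_to v : ~ (exists c : seq (edge E), is_source_cycle c) ->
  exists p q, [/\ path_to v p, path_to v q, size p = size q & p != q].
Proof.
move=> no_cycle.
have [w [vw w_deg]] :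
    exists w, fconnect prev v w /\ #|[set e : edge E | rng e == w]| != 1%N.
  apply: contrapT => no_w; apply: no_cycle; apply: (@source_cycle_of_indegree1 v).
  by move=> w vw; apply: contrapT => /negP w_deg; apply: no_w; exists w.
have [p [pv pw]] := path_to_of_fconnect vw.
have inc_in : inc w \in [set e : edge E | rng e == w] by rewrite inE rng_inc.
(* Since [inc w] already enters w, an in-degree other than 1 yields a second edge e. *)
move: w_deg; rewrite (cardsD1 (inc w)) inc_in eqSS -lt0n => /card_gt0P[e].
rewrite !inE => /andP[e_inc /eqP ew]; exists (e :: p), (inc w :: p).
by split=> /=; rewrite ?pv ?ew ?rng_inc ?pw ?eqseq_cons ?eqxx ?andbT.
Qed.

(** Both paths at v are extended backwards to the maximal length N; they stay distinct because
    dropping the added prefix, equally long for both, recovers the originals. *)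
Lemma uniform_two_paths : ~ (exists c : seq (edge E), is_source_cycle c) ->
  exists N (mu : 'I_2 -> vertex E -> seq (edge E)),
    [/\ forall i v, size (mu i v) = N, forall i v, path_to v (mu i v)
      & forall v, injective (mu^~ v)].
Proof.
move=> no_cycle.
have /choice[p /choice[q pqP]] v := two_paths_to v no_cycle.
pose N := \max_v size (p v).
pose p' (iv : 'I_2 * vertex E) := if iv.1 == 0 then p iv.2 else q iv.2.
have /choice[mu muP] iv : exists r, [/\ size r = N, path_to iv.2 r
    & drop (N - size (p iv.2)) r = p' iv].
  have [pv qv spq _] := pqP iv.2.
  have p'v : path_to iv.2 (p' iv) by rewrite /p'; case: ifP.
  have sp' : size (p' iv) = size (p iv.2) by rewrite /p'; case: ifP.
  have [r [sr rv]] := path_to_extend (N - size (p iv.2)) p'v.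
  exists (r ++ p' iv); split=> //; last by rewrite drop_size_cat.
  by rewrite size_cat sr sp' subnK // (leq_bigmax iv.2).
exists N, (fun i v => mu (i, v)); split=> [i v|i v|v i j /= ij].
- by have [] := muP (i, v).
- by have [] := muP (i, v).
have : p' (i, v) = p' (j, v).
  by have [_ _ <-] := muP (i, v); have [_ _ <-] := muP (j, v); rewrite ij.
have [_ _ _ /eqP pq] := pqP v; rewrite /p' /=.
case: eqP => [->|i0]; case: eqP => [->|j0] //; try by move=> /esym.
have nz1 (k : 'I_2) : k <> 0 -> k = ord_max.
  by case: k => [[|[|k]] k2] // k0; last exact: val_inj; case: k0; apply: val_inj.
by rewrite (nz1 i i0) (nz1 j j0).
Qed.

End NoSource.
End Paths.

Theorem corollary3p17 (E : finite_graph) (K : fieldType) :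
  unbounded_generating_number (cohn_algebra K E) <->
  (exists v : vertex E, is_source v) \/
  (exists c : seq (edge E), is_source_cycle c).
Proof.
split=> [ugn|[[v v_src]|[c c_cyc]]].
- apply: contrapT => /not_orP[no_source no_cycle].
  have /choice[inc rng_inc] v : exists e : edge E, rng e = v.
    apply: contrapT => no_e; apply: no_source; exists v.
    apply/eqP/setP => e; rewrite !inE.
    by apply/eqP => ev; apply: no_e; exists e.
  have [N [mu [size_mu mu_to mu_inj]]] := uniform_two_paths rng_inc no_cycle.
  exact: distinct_paths_not_ugn size_mu mu_to mu_inj ugn.
- have no_e e : rng e != v.
    by move/eqP/setP: v_src => /(_ e); rewrite !inE => ->.
  apply: (@cohn_ugn_of_backward_closed K E [set v]).
  + by apply/set0Pn; exists v; rewrite inE.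
  + by move=> e; rewrite inE (negbTE (no_e e)).
  + by move=> e f; rewrite inE (negbTE (no_e e)).
- have [/andP[/andP[c_neq0 c_path] c_uniq] /allP c_deg] := andP c_cyc.
  (* In-degree 1 at [src f] identifies e with the edge preceding f on the cycle. *)
  have in_c (e : edge E) : rng e \in map (@src E) c -> e \in c.
    case/mapP=> f fc ef.
    have prev_c : prev c f \in c by rewrite mem_prev.
    have fE : rng (prev c f) = src f by apply/eqP; apply: (prev_cycle c_path fc).
    have /cards1P[g gE] := c_deg _ (map_f (@src E) fc).
    have : e \in [set e | rng e == src f] by rewrite inE ef.
    have : prev c f \in [set e | rng e == src f] by rewrite inE fE.
    by rewrite gE !inE => /eqP <- /eqP ->.
  apply: (@cohn_ugn_of_backward_closed K E [set v in map (@src E) c]).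
  + case: c c_neq0 {c_cyc c_path c_uniq c_deg in_c} => // e c _.
    by apply/set0Pn; exists (src e); rewrite !inE eqxx.
  + by move=> e; rewrite !inE => /in_c ec; apply: map_f.
  (* Both edges lie on c, where sources are pairwise distinct. *)
  + move=> e f; rewrite !inE => /in_c ec /in_c fc.
    move=> ef; rewrite -(nth_index e ec) -(nth_index e fc); congr nth.
    apply/eqP; rewrite -(nth_uniq (src e) _ _ c_uniq) ?size_map ?index_mem //.
    by rewrite !(nth_map e) ?index_mem // !nth_index // ef.
Qed.
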